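(* Let $k>1$ be an integer, $p$ a prime, $q=p^r$ with $r\geq1$, and $D=p^{\lfloor\log_p(k)\rfloor+1}$. Let $F(Y_1,\ldots,Y_j)$ be a polynomial with coefficients in $\mathbb{F}_q$ in a fixed number $j$ of variables, and let $L:\mathbb{F}_q\to\mathbb{F}_q$ be a linear function. For $n\geq j$ consider the perturbation $\boldsymbol{e}_{n,k}+F$, i.e. the function $(x_1,\ldots,x_n)\mapsto\boldsymbol{e}_k(x_1,\ldots,x_n)+F(x_1,\ldots,x_j)$ on $\mathbb{F}_q^n$. Then \[ \lim_{n\to\infty}\frac{1}{q^n}\mathrm{S}_{\mathbb{F}_q,L}(\boldsymbol{e}_{n,k}+F;X)=\frac{1}{q^j}\,c^{(q)}_{A,L}(k;X)\,\mathrm{S}_{\mathbb{F}_q,L}(F;X), \] where $\mathrm{S}_{\mathbb{F}_q,L}(F;X)=\sum_{\mathbf{y}\in\mathbb{F}_q^j}X^{L(F(\mathbf{y}))}$ and \[ c^{(q)}_{A,L}(k;X)=\frac{1}{D^{q-1}}\sum_{b_{q-1}=0}^{D-1}\cdots\sum_{b_1=0}^{D-1}X^{L\left(\Lambda_{\mathbb{F}_q^\times}(k,b_1,\ldots,b_{q-1})\right)}. \]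
   Context: $\boldsymbol{e}_{n,k}=\boldsymbol{e}_k(X_1,\ldots,X_n)$ is the elementary symmetric polynomial of degree $k$ in $n$ variables. $X$ is a formal symbol: expressions $\sum_{\beta\in\mathbb{F}_q}c_\beta X^\beta$ are elements of the group algebra of $(\mathbb{F}_q,+)$ over $\mathbb{R}$, with $X^\beta X^\gamma=X^{\beta+\gamma}$ (products are computed in this algebra), and limits are coefficientwise. For $G:\mathbb{F}_q^n\to\mathbb{F}_q$, $\mathrm{S}_{\mathbb{F}_q,L}(G;X)=\sum_{\mathbf{y}\in\mathbb{F}_q^n}X^{L(G(\mathbf{y}))}$. Fix an enumeration $\mathbb{F}_q^\times=\{\alpha_1,\ldots,\alpha_{q-1}\}$; $\Lambda_{\mathbb{F}_q^\times}(k,b_1,\ldots,b_{q-1})$ is the value of $\boldsymbol{e}_k$ at a vector in which each $\alpha_i$ appears exactly $b_i$ times (other entries $0$). *)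

(* Defs.v *)
From HB Require Import structures.
From mathcomp Require Import all_boot all_order all_algebra.
From mathcomp Require Import all_classical all_reals all_analysis.
From mathcomp Require mpoly.

Set Implicit Arguments.
Unset Strict Implicit.
Unset Printing Implicit Defensive.

Import Order.TTheory GRing.Theory Num.Theory.
Import numFieldNormedType.Exports.

Local Open Scope ring_scope.

(* The group algebra R[G] of a finite additive group G, as coefficient
   functions.  It is a separate type from {ffun G -> R} because its product is
   the convolution, not the pointwise product.  (monalg's {malg R[G]} does not
   apply: its monomials must have no nontrivial units.) *)
Definition galg (R : comNzRingType) (G : finZmodType) : Type := {ffun G -> R}.

Section GroupAlgebra.
Variables (R : comNzRingType) (G : finZmodType).
Implicit Types (f g h : {ffun G -> R}) (a b c : G).

HB.instance Definition _ := GRing.Lmodule.copy (galg R G) {ffun G -> R^o}.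

(* The formal power X^a. *)
Definition gX (a : G) : galg R G := [ffun c => (c == a)%:R].

Definition gmul (f g : galg R G) : galg R G :=
  [ffun c => \sum_(ab : G * G | ab.1 + ab.2 == c) f ab.1 * g ab.2].

Lemma gmulE (f g : galg R G) c : gmul f g c = \sum_a f a * g (c - a).
Proof.
rewrite ffunE (reindex (fun a => (a, c - a))) /=.
  by apply: eq_bigl => a; rewrite addrC subrK eqxx.
exists (fun ab : G * G => ab.1) => // -[a b]; rewrite inE /= => /eqP <-.
by rewrite [a + b]addrC addrK.
Qed.

Lemma gmulC : commutative gmul.
Proof.
move=> f g; apply/ffunP => c; rewrite !gmulE (reindex_inj (inv_inj (subKr c))).
by apply: eq_bigr => a _; rewrite subKr mulrC.
Qed.

Lemma gmulA : associative gmul.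
Proof.
move=> f g h; apply/ffunP => c; rewrite !gmulE.
under eq_bigr do rewrite gmulE mulr_sumr.
under [RHS]eq_bigr do rewrite gmulE mulr_suml.
rewrite [RHS]exchange_big; apply: eq_bigr => a _ /=.
rewrite [RHS](reindex_inj (addIr a)); apply: eq_bigr => b _ /=.
by rewrite addrK mulrA opprD addrA [c - b - a]addrAC.
Qed.

Lemma gmul1 : left_id (gX 0) gmul.
Proof.
move=> f; apply/ffunP => c; rewrite gmulE (bigD1 0) //= big1 => [|a /negPf a0].
  by rewrite ffunE eqxx mul1r subr0 addr0.
by rewrite ffunE a0 mul0r.
Qed.

Lemma gmulDl : left_distributive gmul +%R.
Proof.
move=> f g h; apply/ffunP => c; rewrite [RHS]ffunE !gmulE -big_split.
by apply: eq_bigr => a _; rewrite ffunE mulrDl.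
Qed.

Lemma gX_neq0 : gX 0 != 0 :> galg R G.
Proof.
by apply/eqP => /ffunP /(_ 0) /eqP; rewrite !ffunE eqxx oner_eq0.
Qed.

HB.instance Definition _ := GRing.Zmodule_isComNzRing.Build (galg R G)
  gmulA gmulC gmul1 gmulDl gX_neq0.

Lemma gscaleE (z : R) (f : galg R G) c : (z *: f) c = z * f c.
Proof. by rewrite ffunE. Qed.

Lemma gmulrE (f g : galg R G) c : (f * g) c = \sum_a f a * g (c - a).
Proof. exact: gmulE. Qed.

Lemma gscaleAl (z : R) (f g : galg R G) : z *: (f * g) = (z *: f) * g.
Proof.
apply/ffunP => c; rewrite gscaleE !gmulrE mulr_sumr.
by apply: eq_bigr => a _; rewrite gscaleE mulrA.
Qed.

HB.instance Definition _ :=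
  GRing.Lmodule_isLalgebra.Build R (galg R G) gscaleAl.
HB.instance Definition _ :=
  GRing.Lalgebra_isComAlgebra.Build R (galg R G).

Lemma gXD a b : gX (a + b) = gX a * gX b.
Proof.
apply/ffunP => c; rewrite gmulrE ffunE (bigD1 a) //=.
rewrite big1 => [|d /negPf da]; last by rewrite ffunE da mul0r.
by rewrite !ffunE eqxx mul1r addr0 subr_eq [b + a]addrC.
Qed.

End GroupAlgebra.

Definition coefwise_cvg (R : realType) (G : finZmodType)
    (u : nat -> galg R G) (l : galg R G) : Prop :=
  forall a : G, ((fun n => u n a) @ \oo --> l a)%classic.

(* Linearity over the prime subfield {m%:R | m : nat} of F, which covers
   F-linear maps as well as, e.g., the absolute trace. *)
Definition prime_linear (F : finFieldType) (L : F -> F) : Prop :=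
  forall (m : nat) (x y : F), L (m%:R * x + y) = m%:R * L x + L y.

(* S_{F,L}(G; X) *)
Definition expsum (R : realType) (F : finFieldType) (L : F -> F) (n : nat)
    (G : {ffun 'I_n -> F} -> F) : galg R F :=
  \sum_(y : {ffun 'I_n -> F}) gX R (L (G y)).

(* e_k(x_0, ..., x_(n-1)) *)
Definition esymv (F : finFieldType) (k n : nat) (x : 'I_n -> F) : F :=
  mpoly.meval x (mpoly.mesym n F k).

(* The first j coordinates of x.  For n < j, a case irrelevant to the limit
   n -> oo, the missing coordinates are 0. *)
Definition first_coords (F : finFieldType) (j n : nat) (x : 'I_n -> F) : 'I_j -> F :=
  fun i => if insub (val i) is Some i' then x i' else 0.
Arguments first_coords {F} j {n} x i.

Lemma first_coordsE (F : finFieldType) (j n : nat) (le_jn : (j <= n)%N)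
    (x : 'I_n -> F) (i : 'I_j) : first_coords j x i = x (widen_ord le_jn i).
Proof.
have lt_in : (i < n)%N by exact: leq_trans (ltn_ord i) le_jn.
rewrite /first_coords; case: insubP => [i' _ i'E|/negP[]//].
by congr (x _); apply: val_inj.
Qed.

(* (x_0, ..., x_(n-1)) |-> e_k(x_0, ..., x_(n-1)) + P(x_0, ..., x_(j-1)) *)
Definition perturbed (F : finFieldType) (k j : nat) (P : mpoly.mpoly j F)
    (n : nat) (x : {ffun 'I_n -> F}) : F :=
  esymv k x + mpoly.meval (first_coords j x) P.

(* alpha_0, ..., alpha_(m-1) lists every nonzero element of F exactly once. *)
Definition enumerates_units (F : finFieldType) (m : nat) (alpha : 'I_m -> F) :
    Prop :=
  injective alpha /\ forall x : F, x != 0 <-> exists i, alpha i = x.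

(* The vector in which alpha_i is repeated b_i times; neither the order of its
   entries nor the presence of further zero entries affects e_k. *)
Definition repvec (F : finFieldType) (m : nat) (alpha : 'I_m -> F)
    (b : 'I_m -> nat) : seq F :=
  flatten [seq nseq (b i) (alpha i) | i <- enum 'I_m].

Definition Lambda (F : finFieldType) (m : nat) (alpha : 'I_m -> F) (k : nat)
    (b : 'I_m -> nat) : F :=
  esymv k (tnth (in_tuple (repvec alpha b))).

(* D; trunc_log p k is the integer part of the base-p logarithm of k. *)
Definition period (p k : nat) : nat := (p ^ (trunc_log p k).+1)%N.

(* c_{A,L}(k; X), with m = q - 1. *)
Definition cA (R : realType) (F : finFieldType) (L : F -> F) (m : nat)
    (alpha : 'I_m -> F) (p k : nat) : galg R F :=
  let D := period p k in
  (D%:R ^+ m)^-1 *: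
    \sum_(b : {ffun 'I_m -> 'I_D}) gX R (L (Lambda alpha k (fun i => b i))).

(* Main.v *)
From HB Require Import structures.
Require Import Defs.
From mathcomp Require Import all_boot all_order all_algebra.
From mathcomp Require Import all_classical all_reals all_analysis.
From mathcomp Require Import finfield.
From mathcomp Require mpoly.

Set Implicit Arguments.
Unset Strict Implicit.
Unset Printing Implicit Defensive.

Import Order.TTheory GRing.Theory Num.Theory.
Import numFieldNormedType.Exports.

Local Open Scope ring_scope.

(* e_k(x) is the coefficient of T^k in prod_i (1 + x_i T).  Since D is a power
   of p exceeding k, Frobenius gives (1 + a T)^D = 1 modulo T^(k+1), so e_k(x)
   depends only on the endpoint, in H = (Z/D)^(q-1), of the walk that counts
   how often each unit occurs among the x_i modulo D.  The walk driven by
   uniform coordinates has uniform steps in {0, e_1, ..., e_(q-1)}; some fixed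
   number N of steps reaches every point of H, which makes averaging over N
   steps a strict contraction on the functions of zero sum on H, whence the
   endpoint equidistributes, from any starting point.  The first j coordinates
   only determine F(x_1, ..., x_j) and the starting point of the remaining
   walk. *)

(** Equips vectors over Z/D with the finite group structure that the walk needs. *)
HB.instance Definition _ (I : finType) (G : finZmodType) :=
  GRing.Zmodule.on {ffun I -> G}.

(** * Concatenation of vectors *)

Definition catf (T : Type) (m n : nat) (y : {ffun 'I_m -> T})
    (z : {ffun 'I_n -> T}) : {ffun 'I_(m + n) -> T} :=
  [ffun i => match fintype.split i with inl a => y a | inr b => z b end].

Lemma catf_lshift (T : Type) (m n : nat) (y : {ffun 'I_m -> T})
  (z : {ffun 'I_n -> T}) i : catf y z (lshift n i) = y i.
Proof. by rewrite ffunE (unsplitK (inl i)). Qed.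

Lemma catf_rshift (T : Type) (m n : nat) (y : {ffun 'I_m -> T})
  (z : {ffun 'I_n -> T}) i : catf y z (rshift m i) = z i.
Proof. by rewrite ffunE (unsplitK (inr i)). Qed.

Lemma sum_catf (T : finType) (V : nmodType) (m n : nat)
    (g : {ffun 'I_(m + n) -> T} -> V) :
  \sum_x g x = \sum_(y : {ffun 'I_m -> T}) \sum_(z : {ffun 'I_n -> T})
                 g (catf y z).
Proof.
rewrite pair_bigA (reindex (fun yz => catf yz.1 yz.2)) //=.
apply: onW_bij.
exists (fun x : {ffun 'I_(m + n) -> T} =>
          ([ffun i => x (lshift n i)], [ffun i => x (rshift m i)])).
  move=> [y z]; congr pair; apply/ffunP => i; rewrite ffunE /=.
    exact: catf_lshift.
  exact: catf_rshift.
move=> x; apply/ffunP => i; rewrite ffunE /=.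
by case: split_ordP => a ->; rewrite ffunE.
Qed.

(** * Equidistribution of a random walk on a finite abelian group *)

Section RandomWalk.
Variables (R : realType) (H : finZmodType) (T : finType) (s : T -> H).
Implicit Types (f g : H -> R) (h : H).

Definition walk_end n (x : {ffun 'I_n -> T}) : H := \sum_i s (x i).

Lemma walk_end_catf m n (y : {ffun 'I_m -> T}) (z : {ffun 'I_n -> T}) :
  walk_end (catf y z) = walk_end y + walk_end z.
Proof.
rewrite /walk_end big_split_ord /=.
by congr (_ + _); apply: eq_bigr => i _; rewrite (catf_lshift, catf_rshift).
Qed.

(** The [n]-step transition operator of the walk with uniform steps. *)
Definition walk_avg n f h : R :=
  (#|T|%:R ^+ n)^-1 * \sum_(x : {ffun 'I_n -> T}) f (h + walk_end x).

Lemma walk_avgD m n f h : walk_avg (m + n) f h = walk_avg m (walk_avg n f) h.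
Proof.
rewrite /walk_avg sum_catf exprD invfM -mulrA; congr (_ * _).
rewrite mulr_sumr; apply: eq_bigr => y _; congr (_ * _).
by apply: eq_bigr => z _; rewrite walk_end_catf addrA.
Qed.

Hypothesis T_gt0 : (0 < #|T|)%N.

Let cardT_gt0 n : 0 < #|T|%:R ^+ n :> R.
Proof. by rewrite exprn_gt0 // ltr0n. Qed.

Let cardT_neq0 n : #|T|%:R ^+ n != 0 :> R.
Proof. exact: lt0r_neq0. Qed.

Lemma sum_walk_cst n (c : R) :
  \sum_(x : {ffun 'I_n -> T}) c = #|T|%:R ^+ n * c.
Proof. by rewrite sumr_const card_ffun card_ord -natrX mulr_natl. Qed.

(** Each path acts on [H] by a translation, which preserves the total; hence averaging keeps a zero
    sum. *)
Lemma sum_walk_avg n f : \sum_h walk_avg n f h = \sum_h f h.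
Proof.
rewrite -mulr_sumr exchange_big /=.
have shiftf (a : H) : \sum_h f (h + a) = \sum_h f h.
  by rewrite [RHS](reindex_inj (addIr a)).
under eq_bigr => x _ do rewrite shiftf.
by rewrite sum_walk_cst mulKf.
Qed.

Lemma walk_avg_le n f (C : R) h : (forall h, `|f h| <= C) ->
  `|walk_avg n f h| <= C.
Proof.
move=> fC; rewrite normrM gtr0_norm ?invr_gt0 // mulrC ler_pdivrMr // mulrC.
rewrite -sum_walk_cst.
by apply: le_trans (ler_norm_sum _ _ _) _; apply: ler_sum.
Qed.

Variable N : nat.
Hypothesis reach : forall h, exists x : {ffun 'I_N -> T}, walk_end x = h.

(** The proportion of paths of length [N] that remain once one path to each point of [H] is
    discarded. *)
Let rho : R := 1 - #|H|%:R / #|T|%:R ^+ N.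

(* Pick one path of length N to each point of H: since f has zero sum, these
   paths contribute nothing, so they can be left out of the average. *)
Lemma walk_avg_contract f (C : R) h : \sum_h f h = 0 ->
  (forall h, `|f h| <= C) -> `|walk_avg N f h| <= rho * C.
Proof.
move=> f0 fC; have [sg sgK] := fin_all_exists reach.
have sg_inj : injective sg by exact: can_inj sgK.
rewrite normrM gtr0_norm ?invr_gt0 // mulrC ler_pdivrMr //.
rewrite (bigID [in codom sg]) /=.
have -> : \sum_(x in codom sg) f (h + walk_end x) = 0.
  have uniq_codom : uniq (codom sg) by rewrite map_inj_uniq ?enum_uniq.
  rewrite -[in RHS]f0 -(big_uniq _ uniq_codom) /= big_map big_enum /=.
  rewrite [RHS](reindex_inj (addrI h)) /=.
  by apply: eq_bigr => a _; rewrite sgK.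
rewrite add0r; apply: le_trans (ler_norm_sum _ _ _) _.
apply: (@le_trans _ _ (\sum_(x | x \notin codom sg) C)); first exact: ler_sum.
rewrite mulrAC mulrBl mul1r divfK // sumr_const.
have := cardC (mem (codom sg)); rewrite card_codom // card_ffun card_ord.
rewrite -natrX => <-; rewrite natrD addrC addKr mulr_natl.
exact: lexx.
Qed.

Let rho_ge0 : 0 <= rho.
Proof.
rewrite subr_ge0 ler_pdivrMr // mul1r -natrX ler_nat.
have [sg sgK] := fin_all_exists reach.
by have := leq_card sg (can_inj sgK); rewrite card_ffun card_ord.
Qed.

Let rho_lt1 : rho < 1.
Proof.
rewrite ltrBlDr ltrDl divr_gt0 // ltr0n.
by apply/card_gt0P; exists 0.
Qed.

(** Every block of [N] steps gains a factor [rho], since the function averaged so far still has zero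
    sum. *)
Lemma walk_avg_iter_contract t f (C : R) h : \sum_h f h = 0 ->
  (forall h, `|f h| <= C) -> `|walk_avg (t * N) f h| <= rho ^+ t * C.
Proof.
move=> f0 fC; elim: t h => [|t IHt] h.
  by rewrite expr0 mul1r; exact: walk_avg_le.
rewrite mulSn walk_avgD exprS -mulrA.
by apply: walk_avg_contract => //; rewrite sum_walk_avg.
Qed.

Lemma walk_avg_cvg0 f h : \sum_h f h = 0 ->
  ((fun n => walk_avg n f h) @ \oo --> (0 : R))%classic.
Proof.
move=> f0; pose C := \sum_h `|f h|.
have fC a : `|f a| <= C.
  by rewrite /C (bigD1 a) //= lerDl sumr_ge0.
apply/cvgr0Pnorm_le => e e0.
have /cvgr0Pnorm_le/(_ e e0) :
    ((fun t => rho ^+ t * C) @ \oo --> (0 : R))%classic.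
  rewrite -[X in (_ --> X)%classic](mul0r C).
  by apply: cvgMl; apply: cvg_expr; rewrite ger0_norm.
case=> t _ /(_ t (leqnn t)) rhot.
exists (t * N)%N => // n /= tNn.
(* The [n - t * N] leftover steps form the inner average, which keeps the zero sum and the bound
   [C]; the [t] blocks then contract it. *)
rewrite -(subnKC tNn) walk_avgD.
have := walk_avg_iter_contract t h (etrans (sum_walk_avg (n - t * N) f) f0)
  (fun a => walk_avg_le (n - t * N) a fC).
by move=> /le_trans; apply; apply: le_trans (ler_norm _) rhot.
Qed.

Lemma walk_avg_cvg f h :
  ((fun n => walk_avg n f h) @ \oo --> #|H|%:R^-1 * \sum_h f h)%classic.
Proof.
(* Averaging fixes constants, so subtracting the mean [M] reduces to zero sum. *)
set M : R := _ * _; pose g a := f a - M.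
have H_neq0 : #|H|%:R != 0 :> R.
  by rewrite pnatr_eq0 -lt0n; apply/card_gt0P; exists 0.
have g0 : \sum_h g h = 0.
  by rewrite sumrB sumr_const -[M *+ _]mulr_natl mulVKf // subrr.
have -> : (fun n => walk_avg n f h) = (fun n => walk_avg n g h + M).
  apply/funext => n; rewrite /walk_avg /g sumrB sum_walk_cst mulrBr.
  by rewrite mulKf // subrK.
rewrite -[X in (_ --> X)%classic]add0r.
by apply: cvgD; [exact: walk_avg_cvg0 | exact: cvg_cst].
Qed.

End RandomWalk.

(** * Generating polynomials modulo a power of the variable *)

Section TruncatedProducts.
Variable F : comNzRingType.
Implicit Types (p q r : {poly F}) (k : nat).

Definition eq_upto k p q := forall i, (i <= k)%N -> p`_i = q`_i.

Lemma eq_upto_trans k p q r : eq_upto k p q -> eq_upto k q r -> eq_upto k p r.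
Proof. by move=> pq qr i ik; rewrite pq // qr. Qed.

Lemma eq_uptoM k p p' q q' :
  eq_upto k p p' -> eq_upto k q q' -> eq_upto k (p * q) (p' * q').
Proof.
move=> pp' qq' i ik; rewrite !coefM; apply: eq_bigr => -[a /= lt_ai] _.
by rewrite pp' ?qq' // (leq_trans _ ik) // leq_subr.
Qed.

Lemma eq_upto_prod k (I : finType) (p q : I -> {poly F}) :
  (forall i, eq_upto k (p i) (q i)) ->
  eq_upto k (\prod_i p i) (\prod_i q i).
Proof.
move=> pq; elim/big_rec2: _ => // i x y _ xy.
exact: eq_uptoM.
Qed.

Definition onepX (x : F) : {poly F} := 1 + x *: 'X.

End TruncatedProducts.

(** Expanding the product picks a subset [A] of the variables, whose term has degree [#|A|]. *)
Lemma esymvE (F : finFieldType) k n (x : 'I_n -> F) :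
  esymv k x = (\prod_i onepX (x i))`_k.
Proof.
rewrite /esymv /mpoly.mesym.
rewrite (big_morph _ (mpoly.mevalD x) (mpoly.meval0 x)).
under [in RHS]eq_bigr do rewrite /onepX addrC.
rewrite bigA_distr coef_sum big_mkcond /=; apply: eq_bigr => A _.
rewrite (big_morph _ (mpoly.mevalM x) (mpoly.meval1 x)) -big_mkcond /=.
rewrite scaler_prod prodr_const coefZ coefXn.
rewrite eq_sym; under eq_bigr do rewrite mpoly.mevalXU.
by case: eqP; rewrite ?mulr1 ?mulr0.
Qed.

(** * Elementary symmetric values from counts modulo D *)

Section Counts.
Variables (F : finFieldType) (m k D' : nat) (alpha : 'I_m -> F).
(** The successor form gives ['I_D] its cyclic group structure. *)
Let D := D'.+1.
Hypotheses (D_gt1 : (1 < D)%N) (k_ltD : (k < D)%N).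
Hypotheses (D_pchar : [pchar F].-nat D).
Hypothesis alpha_enum : enumerates_units alpha.
Implicit Types (b : {ffun 'I_m -> 'I_D}).

Lemma onepX_expD (x : F) : eq_upto k (onepX x ^+ D) 1.
Proof.
move=> i ik; rewrite exprDn_pchar; last first.
  by rewrite (eq_pnat _ (pchar_poly F)).
by rewrite expr1n exprZn coefD coefZ coefXn ltn_eqF ?(leq_ltn_trans ik) //
  ?mulr0 ?addr0.
Qed.

Lemma onepX_exp_mod (x : F) n : eq_upto k (onepX x ^+ (n %% D)) (onepX x ^+ n).
Proof.
rewrite [in X in eq_upto _ _ X](divn_eq n D) addnC exprD.
rewrite -[X in eq_upto _ X _]mulr1; apply: eq_uptoM => //.
rewrite mulnC exprM; elim: (n %/ D)%N => [|t IHt] //.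
rewrite exprS -[1]mulr1; apply: eq_uptoM => //.
by move=> i ik; rewrite onepX_expD.
Qed.

Definition count_prod (b : 'I_m -> nat) : {poly F} :=
  \prod_a onepX (alpha a) ^+ b a.

Lemma LambdaE (b : 'I_m -> nat) : Lambda alpha k b = (count_prod b)`_k.
Proof.
rewrite /Lambda esymvE; congr (polyseq _)`_k.
rewrite -(big_tuple _ _ (in_tuple _) xpredT (@onepX F)) /= /repvec.
rewrite big_flatten big_map big_enum /count_prod /=.
by apply: eq_big => // a _; rewrite big_nseq iter_mulr_1.
Qed.

(** Addition in [b + b'] wraps around modulo [D], and [onepX_exp_mod] absorbs the wrap. *)
Lemma count_prodD b b' : eq_upto k (count_prod (fun a => (b + b') a))
  (count_prod (fun a => b a) * count_prod (fun a => b' a)).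
Proof.
rewrite /count_prod -big_split /=; apply: eq_upto_prod => a.
by rewrite -exprD ffunE; apply: onepX_exp_mod.
Qed.

(** The basis vector of the index of [x] if [x] is a unit, the zero vector if [x] is 0. *)
Definition unit_step (x : F) : {ffun 'I_m -> 'I_D} :=
  [ffun a => inord (alpha a == x)].

Lemma count_prod_step (x : F) : count_prod (fun a => unit_step x a) = onepX x.
Proof.
(* As [D > 1], [inord] keeps both 0 and 1. *)
have stepE a : unit_step x a = (alpha a == x) :> nat.
  by rewrite ffunE inordK //; case: eqP => // _; apply: ltnW.
rewrite /count_prod; under eq_bigr do rewrite stepE.
have [alpha_inj alphaP] := alpha_enum.
have [-> | /alphaP[a <-]] := eqVneq x 0.
  rewrite big1 /onepX ?scale0r ?addr0 // => a _.
  by rewrite (negPf (_ : alpha a != 0)) //; apply/alphaP; exists a.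
rewrite (bigD1 a) //= eqxx big1 ?mulr1 // => c ca.
by rewrite (inj_eq alpha_inj) (negPf ca).
Qed.

Lemma count_prod_walk n (x : {ffun 'I_n -> F}) :
  eq_upto k (count_prod (fun a => walk_end unit_step x a))
    (\prod_i onepX (x i)).
Proof.
rewrite /walk_end; elim/big_rec2: _ => [|i q b _ IH].
  by rewrite /count_prod big1 // => a _; rewrite ffunE.
apply: eq_upto_trans (count_prodD _ _) _.
by apply: eq_uptoM => //; rewrite count_prod_step.
Qed.

Lemma esymv_walk n (x : {ffun 'I_n -> F}) :
  esymv k x = Lambda alpha k (fun a => walk_end unit_step x a).
Proof. by rewrite esymvE LambdaE count_prod_walk. Qed.

Lemma unit_step0 : unit_step 0 = 0.
Proof.
apply/ffunP => a; rewrite !ffunE; have [_ alphaP] := alpha_enum.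
rewrite (negPf (_ : alpha a != 0)); last by apply/alphaP; exists a.
by apply: val_inj; rewrite /= inordK.
Qed.

(** The path has one slot per pair [(a, t)], holding [alpha a] if [t < b a] and 0 otherwise, so
    [alpha a] occurs [b a] times; its length does not depend on [b]. *)
Lemma unit_step_reach b :
  exists x : {ffun 'I_(#|{: 'I_m * 'I_D}|) -> F}, walk_end unit_step x = b.
Proof.
pose y (u : 'I_m * 'I_D) := if (u.2 < b u.1)%N then alpha u.1 else 0.
exists [ffun i => y (enum_val i)]; rewrite /walk_end.
under eq_bigr do rewrite ffunE.
transitivity (\sum_u unit_step (y u)).
  by rewrite [RHS](reindex _ (onW_bij _ (@enum_val_bij _))).
rewrite -(pair_bigA _ (fun a t => unit_step (y (a, t)))) /=.
have [alpha_inj _] := alpha_enum.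
apply/ffunP => c; rewrite sum_ffunE (bigD1 c) //= [X in _ + X]big1; last first.
  move=> a ac; rewrite sum_ffunE big1 // => t _; rewrite /y /=.
  case: ifP => _; last by rewrite unit_step0 ffunE.
  rewrite ffunE (inj_eq alpha_inj) eq_sym (negPf ac).
  by apply: val_inj; rewrite /= inordK.
rewrite addr0 sum_ffunE.
transitivity (\sum_(t < D | (t < b c)%N) (inord 1 : 'I_D)).
  rewrite [RHS]big_mkcond; apply: eq_bigr => t _; rewrite /y /=.
  by case: ifP => _; rewrite ?unit_step0 ffunE ?eqxx.
rewrite -(big_ord_widen D (fun=> inord 1 : 'I_D)) ?(ltnW (ltn_ord _)) //.
rewrite sumr_const card_ord Zp_mulrn; apply: val_inj.
by rewrite /= inordK // mul1n modn_small.
Qed.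

End Counts.

(** * Passage to the limit, coefficient by coefficient *)

Lemma galg_sumE (R : comNzRingType) (G : finZmodType) (I : finType)
    (u : I -> galg R G) (c : G) : (\sum_i u i) c = \sum_i u i c.
Proof. exact: sum_ffunE. Qed.

Lemma meval_first_coords_catf (F : finFieldType) j n (P : mpoly.mpoly j F)
    (y : {ffun 'I_j -> F}) (z : {ffun 'I_n -> F}) :
  mpoly.meval (first_coords j (catf y z)) P = mpoly.meval y P.
Proof.
apply: mpoly.meval_eq => i; rewrite (first_coordsE (leq_addr n j)).
by rewrite -(catf_lshift y z); congr (catf y z _); apply: val_inj.
Qed.

Lemma period_pchar (F : finFieldType) (p r k : nat) :
  prime p -> #|F| = (p ^ r)%N -> [pchar F].-nat (period p k).
Proof.
move=> p_prime cardF; rewrite pnatX (pnatE _ p_prime).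
by rewrite (card_finPcharP cardF).
Qed.

Theorem theorem2p5 (R : realType) (F : finFieldType) (p r k j : nat)
    (k_gt1 : (1 < k)%N) (p_prime : prime p) (r_ge1 : (1 <= r)%N)
    (cardF : #|F| = (p ^ r)%N)
    (alpha : 'I_(p ^ r).-1 -> F) (alpha_enum : enumerates_units alpha)
    (P : mpoly.mpoly j F) (L : F -> F) (L_lin : prime_linear L) :
  let q := (p ^ r)%N in
  coefwise_cvg
    (fun n : nat => (q%:R ^+ n)^-1 *: expsum R L (@perturbed F k j P n))
    ((q%:R ^+ j)^-1 *:
       (cA R L alpha p k
        * expsum R L (fun y : {ffun 'I_j -> F} => mpoly.meval y P))).
Proof.
move=> q c; have D_pchar := period_pchar k p_prime cardF.
have k_ltD : (k < period p k)%N by rewrite trunc_log_ltn ?prime_gt1.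
rewrite /cA; move: D_pchar k_ltD; case: (period p k) => [//|D'] D_pchar k_ltD.
have D_gt1 : (1 < D'.+1)%N by exact: ltn_trans k_ltD.
pose H := {ffun 'I_q.-1 -> 'I_D'.+1}; pose s : F -> H := unit_step D' alpha.
have LD x y : L (x + y) = L x + L y by have := L_lin 1%N x y; rewrite !mul1r.
(* The coefficient at [c] of the monomial contributed by a prefix [y] and an endpoint [h]. *)
pose f (y : {ffun 'I_j -> F}) (h : H) : R :=
  (c == L (Lambda alpha k (fun i => h i)) + L (mpoly.meval y P))%:R.
have F_gt0 : (0 < #|F|)%N by apply/card_gt0P; exists 0.
(* Since [#|H|] is [D ^ (q - 1)], the claimed limit averages over [y] the mean of [f y] on [H]. *)
have -> : ((q%:R ^+ j)^-1 *: ((D'.+1%:R ^+ q.-1)^-1 *: (\sum_(b : H)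
    gX R (L (Lambda alpha k (fun i => b i))))
    * expsum R L (fun y : {ffun 'I_j -> F} => mpoly.meval y P))) c =
  (q%:R ^+ j)^-1 * \sum_y (#|{: H}|%:R^-1 * \sum_h f y h).
  rewrite -scalerAl !gscaleE /expsum card_ffun !card_ord natrX -mulr_sumr.
  congr (_ * (_ * _)); rewrite mulr_sumr galg_sumE; apply: eq_bigr => y _.
  rewrite mulr_suml galg_sumE; apply: eq_bigr => h _.
  by rewrite -gXD ffunE.
(* With [n + j] variables, the first [j] form [y] and the other [n] drive a walk started at
   [walk_end s y]. *)
rewrite -(cvg_shiftn j).
have -> : (fun n => ((q%:R ^+ (n + j))^-1
    *: expsum R L (@perturbed F k j P (n + j))) c) =
  (fun n => (q%:R ^+ j)^-1 * \sum_y walk_avg s n (f y) (walk_end s y)).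
  apply/funext => n; rewrite addnC gscaleE exprD invfM -mulrA /expsum galg_sumE.
  congr (_ * _); rewrite sum_catf mulr_sumr; apply: eq_bigr => y _.
  rewrite /walk_avg cardF; congr (_ * _); apply: eq_bigr => z _.
  rewrite ffunE /perturbed meval_first_coords_catf LD /f.
  by rewrite (esymv_walk D_gt1 k_ltD D_pchar alpha_enum) walk_end_catf.
(* The sum over [y] is finite, and each walk average tends to the mean of [f y] whatever its
   starting point. *)
apply: cvgMr; apply: (cvg_big add_continuous) => y _.
apply: walk_avg_cvg => //.
exact: unit_step_reach.
Qed.
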